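(* The set of max-characteristic functions of generators of $D$-norms on $\mathbb{R}^d$ is not closed in the sense of pointwise convergence; that is, there is a sequence of max-characteristic functions of generators of $D$-norms on $\mathbb{R}^d$ which converges pointwise on $[0,\infty)^d$ to a function that is not the max-characteristic function of any generator of a $D$-norm on $\mathbb{R}^d$.
   Context: $d\ge1$ is an integer. A norm $\|\cdot\|_D$ on $\mathbb{R}^d$ is a $D$-norm if there exists a random vector $Z=(Z_1,\dots,Z_d)$ with $Z_i\ge 0$ and $\mathrm{E}(Z_i)=1$ for $1\le i\le d$ such that $\|x\|_D=\mathrm{E}\{\max_{1\le i\le d}(|x_i|Z_i)\}$ for all $x\in\mathbb{R}^d$; such a $Z$ is called a generator of $\|\cdot\|_D$. (Every random vector with nonnegative components of expectation $1$ is the generator of a $D$-norm.) The max-characteristic function of a random vector $Z$ with nonnegative integrable components is $\varphi_Z:[0,\infty)^d\to\mathbb{R}$, $\varphi_Z(x)=\mathrm{E}\{\max(1,x_1Z_1,\dots,x_dZ_d)\}$. *)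

(* Defs.v *)
From HB Require Import structures.
From mathcomp Require Import all_boot all_order all_algebra.
From mathcomp Require Import all_classical all_reals all_analysis.

Set Implicit Arguments.
Unset Strict Implicit.
Unset Printing Implicit Defensive.

Import Order.TTheory GRing.Theory Num.Theory.
Import numFieldNormedType.Exports.

Local Open Scope classical_set_scope.
Local Open Scope ring_scope.

Definition is_norm (R : realType) (d : nat) (N : 'rV[R]_d -> R) : Prop :=
  [/\ forall x, N x = 0 -> x = 0,
      forall a x, N (a *: x) = `|a| * N x
    & forall x y, N (x + y) <= N x + N y].

(* A random vector in R^d is given by its d components: for the Borel
   sigma-algebra, measurability into R^d is componentwise measurability.
   The expectation is extended-real valued, so the last clause also says that
   the expectation of the maximum is finite. *)
Definition generates (R : realType) (d : nat) (disp : measure_display)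
    (T : measurableType disp) (P : probability T R)
    (Z : 'I_d -> {RV P >-> R}) (N : 'rV[R]_d -> R) : Prop :=
  [/\ forall i t, 0 <= Z i t,
      forall i, 'E_P[Z i]%E = 1%E
    & forall x : 'rV[R]_d,
        'E_P[fun t => (\big[Order.max/0]_(i < d) (`|x ord0 i| * Z i t))%R]%E
        = (N x)%:E].

Definition is_Dnorm (R : realType) (d : nat) (N : 'rV[R]_d -> R) : Prop :=
  is_norm N /\
  exists (disp : measure_display) (T : measurableType disp)
    (P : probability T R) (Z : 'I_d -> {RV P >-> R}), generates Z N.

Definition is_Dnorm_generator (R : realType) (d : nat)
    (disp : measure_display) (T : measurableType disp) (P : probability T R)
    (Z : 'I_d -> {RV P >-> R}) : Prop :=
  exists N : 'rV[R]_d -> R, is_Dnorm N /\ generates Z N.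

Definition orthant (R : realType) (d : nat) : Type :=
  {x : 'rV[R]_d | [forall i, 0 <= x ord0 i]}.

(* [fine] is harmless for integrable components, as the expectation is then
   finite. *)
Definition max_cf (R : realType) (d : nat) (disp : measure_display)
    (T : measurableType disp) (P : probability T R)
    (Z : 'I_d -> {RV P >-> R}) (x : orthant R d) : R :=
  fine 'E_P[fun t => (\big[Order.max/1]_(i < d) (sval x ord0 i * Z i t))%R]%E.

(* The generators range over all probability spaces. *)
Definition Dnorm_max_cfs (R : realType) (d : nat) : set (orthant R d -> R) :=
  [set phi | exists (disp : measure_display) (T : measurableType disp)
    (P : probability T R) (Z : 'I_d -> {RV P >-> R}),
    is_Dnorm_generator Z /\ phi = max_cf Z].

Arguments Dnorm_max_cfs R d : clear implicits.

(* Main.v *)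
Require Import Defs.
From HB Require Import structures.
From mathcomp Require Import all_boot all_order all_algebra.
From mathcomp Require Import all_classical all_reals all_analysis.
From mathcomp Require Import lra.
Import Order.TTheory GRing.Theory Num.Theory.
Import numFieldNormedType.Exports.
Local Open Scope classical_set_scope.
Local Open Scope ring_scope.

(** Mass can escape to infinity while all expectations stay equal to 1.  Let
    all components of [Z] coincide with a variable that takes the value [n + 1]
    with probability [p = 1 / (n + 1)] and [0] otherwise.  This generates the
    sup-norm, and with [m = max_i x_i] its max-characteristic function is
    [p * max(1, m (n + 1)) + (1 - p) = max(p, m) + (1 - p)], which tends to
    [1 + m] ([max_cf_rare], [cvg_max_cf_rare]).

    The limit belongs to no generator.  Evaluated at a basis vector [e_j] it
    would give [E max(1, Z_j) = 2 = E 1 + E Z_j].  Since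
    [min(1, t) + max(1, t) = 1 + t], this forces [E min(1, Z_j) = 0], hence
    [Z_j = 0] almost surely, contradicting [E Z_j = 1]
    ([ge0_expectation_max1_neq2]). *)

Definition coord_max {R : realType} {d : nat} (x : 'rV[R]_d) : R :=
  \big[Order.max/0]_(i < d) x ord0 i.

Definition sup_norm {R : realType} {d : nat} (x : 'rV[R]_d) : R :=
  \big[Order.max/0]_(i < d) `|x ord0 i|.

Lemma bigmax_pMl (R : realDomainType) (I : Type) (r : seq I) (c : R)
    (F : I -> R) : 0 <= c ->
  \big[Order.max/0]_(i <- r) (c * F i) = c * \big[Order.max/0]_(i <- r) F i.
Proof.
move=> c0; symmetry; apply: (big_morph (fun t => c * t)); last exact: mulr0.
by move=> x y; rewrite maxr_pMr.
Qed.

(** Separates the constant [1] in a max-characteristic function from the maximum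
    of the weighted components, whose natural neutral element is [0]. *)
Lemma bigmax_raise_id (R : realDomainType) (I : Type) (r : seq I) (a b : R)
    (F : I -> R) : a <= b ->
  \big[Order.max/b]_(i <- r) F i = Order.max b (\big[Order.max/a]_(i <- r) F i).
Proof.
move=> ab; elim/big_rec2: _ => [|i y1 y2 _ ->]; last exact: maxCA.
by rewrite (max_idPl ab).
Qed.

Lemma coord_max_ge0 (R : realType) (d : nat) (x : 'rV[R]_d) :
  0 <= coord_max x.
Proof. exact: bigmax_ge_id. Qed.

Lemma sup_norm_is_norm (R : realType) (d : nat) :
  is_norm (@sup_norm R d).
Proof.
split=> [x x0|a x|x y].
- apply/rowP => i; rewrite mxE; apply/normr0_eq0/le_anti.
  by rewrite normr_ge0 andbT -x0 (le_bigmax _ (fun i => `|x ord0 i|)).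
- rewrite /sup_norm -bigmax_pMl//.
  by apply: eq_bigr => i _; rewrite mxE normrM.
- apply: bigmax_le => [|i _]; first by rewrite addr_ge0// bigmax_ge_id.
  rewrite mxE (le_trans (ler_normD _ _))// lerD//.
    exact: (le_bigmax _ (fun i => `|x ord0 i|)).
  exact: (le_bigmax _ (fun i => `|y ord0 i|)).
Qed.

Lemma measurable_fun_bool_dom (R : realType) (f : bool -> R) :
  measurable_fun setT f.
Proof. by move=> _ ? _. Qed.

Definition rare_prob (R : realType) (n : nat) : probability bool R :=
  bernoulli_prob (n.+1%:R^-1 : R).

Definition rare_value (R : realType) (n : nat) (b : bool) : R :=
  if b then n.+1%:R else 0.

HB.instance Definition _ (R : realType) (n : nat) :=
  isMeasurableFun.Build _ _ _ _ (rare_value R n)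
    (measurable_fun_bool_dom R (rare_value R n)).

Definition rare_vector (R : realType) (d n : nat) (i : 'I_d) :
  {RV rare_prob R n >-> R} := rare_value R n.

Lemma expectation_rare (R : realType) (n : nat) (f : bool -> R) :
  (forall b, 0 <= f b) ->
  ('E_(rare_prob R n)[f] =
   (n.+1%:R^-1 * f true + (1 - n.+1%:R^-1) * f false)%:E)%E.
Proof.
move=> f0; rewrite unlock integral_bernoulli_prob; first last.
- by move=> b; rewrite lee_fin.
- by rewrite invr_ge0 ler0n/= invf_le1 ?ltr0n// ler1n.
by [].
Qed.

Lemma rare_vector_generates (R : realType) (d n : nat) :
  generates (rare_vector R d n) (@sup_norm R d).
Proof.
split=> [i t|i|x].
- by case: t => /=.
- rewrite expectation_rare => [|[]//] /=.
  by rewrite mulr0 addr0 mulVf// pnatr_eq0.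
- rewrite expectation_rare => [|t]; last exact: bigmax_ge_id.
  have E t : \big[Order.max/0]_(i < d) (`|x ord0 i| * rare_vector R d n i t) =
      rare_value R n t * sup_norm x.
    rewrite -bigmax_pMl; last by case: t => /=.
    by apply: eq_bigr => i _; rewrite mulrC.
  by rewrite !E/= mul0r mulr0 addr0 mulKf// pnatr_eq0.
Qed.

Lemma rare_vector_Dnorm_generator (R : realType) (d n : nat) :
  is_Dnorm_generator (rare_vector R d n).
Proof.
exists (@sup_norm R d); split; last exact: rare_vector_generates.
split; first exact: sup_norm_is_norm.
by do 4 eexists; exact: rare_vector_generates.
Qed.

(** [p * max(1, m (n + 1)) = max(p, m)] because [p] is the inverse of [n + 1]. *)
Lemma max_cf_rare (R : realType) (d n : nat) (x : orthant R d) :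
  max_cf (rare_vector R d n) x =
  Order.max n.+1%:R^-1 (coord_max (sval x)) + (1 - n.+1%:R^-1).
Proof.
rewrite /max_cf expectation_rare => [|t]; last first.
  by rewrite (le_trans ler01)// bigmax_ge_id.
have E t : \big[Order.max/1]_(i < d) (sval x ord0 i * rare_vector R d n i t) =
    Order.max 1 (rare_value R n t * coord_max (sval x)).
  rewrite -bigmax_pMl; last by case: t => /=.
  rewrite (@bigmax_raise_id _ _ _ 0 1)//.
  by congr Order.max; apply: eq_bigr => i _; rewrite mulrC.
rewrite !E/= mul0r (max_idPl (@ler01 R)) mulr1; congr (_ + _).
by rewrite maxr_pMr ?invr_ge0// mulr1 mulKf// pnatr_eq0.
Qed.

(** Squeezing: for [p, m >= 0], the value [max(p, m) + (1 - p)] lies between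
    [1 + m - p] and [1 + m]. *)
Lemma cvg_max_cf_rare (R : realType) (d : nat) (x : orthant R d) :
  max_cf (rare_vector R d n) x @[n --> \oo] --> 1 + coord_max (sval x).
Proof.
set m := coord_max (sval x).
have m0 : 0 <= m by exact: coord_max_ge0.
apply: (@squeeze_cvgr _ _ _ _ (fun n => 1 + m - harmonic n) (fun=> 1 + m)).
- near=> n; rewrite max_cf_rare -/m /=.
  have : 0 <= n.+1%:R^-1 :> R by rewrite invr_ge0.
  by move: (n.+1%:R^-1) => p p0; case: (leP p m) => pm; apply/andP; split; lra.
- rewrite -[X in _ --> X]subr0; apply: cvgB; first exact: cvg_cst.
  exact: cvg_harmonic.
- exact: cvg_cst.
Unshelve. all: by end_near.
Qed.

(** The bound [max(1, X) <= 1 + X] is strict wherever [X > 0], so the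
    expectations of the two sides agree only if [X] vanishes almost surely. *)
Lemma ge0_expectation_max1_neq2 (disp : measure_display)
    (T : measurableType disp) (R : realType) (P : probability T R)
    (X : {RV P >-> R}) : (forall t, 0 <= X t) -> 'E_P[X]%E = 1%E ->
  'E_P[fun t => (Order.max 1 (X t))%R]%E <> 2%:E.
Proof.
move=> X0 EX Emax.
have mX : measurable_fun setT X by [].
have mmin : measurable_fun setT (fun t => Order.min 1 (X t) : R).
  exact: measurable_realfun.measurable_minr.
have mmax : measurable_fun setT (fun t => Order.max 1 (X t) : R).
  exact: measurable_realfun.measurable_maxr.
have min0 t : 0 <= Order.min 1 (X t) by rewrite le_min ler01 X0.
have Emin : (\int[P]_t (Order.min 1 (X t))%R%:E = 0)%E.
  have : (\int[P]_t ((Order.min 1 (X t))%R%:E + (Order.max 1 (X t))%R%:E) =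
          \int[P]_t (1%:E + (X t)%:E))%E.
    by apply: eq_integral => t _; rewrite -!EFinD addr_min_max.
  rewrite !ge0_integralD//; first last.
  - exact/measurable_realfun.measurable_EFinP.
  - by move=> t _; rewrite lee_fin le_max ler01.
  - exact/measurable_realfun.measurable_EFinP.
  - by move=> t _; rewrite lee_fin.
  - exact/measurable_realfun.measurable_EFinP.
  - by move=> t _; rewrite lee_fin.
  move: EX Emax; rewrite unlock => -> ->.
  rewrite integral_cst// mul1e /= probability_setT -EFinD.
  have : (0 <= \int[P]_t (Order.min 1 (X t))%R%:E)%E.
    by apply: integral_ge0 => t _; rewrite lee_fin.
  (* The identity reads [E min + 2 = 1 + 1]; it excludes an infinite [E min]. *)
  by case: (integral _ _ _) => // r _; rewrite -EFinD => -[rE]; congr EFin; lra.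
have X_ae0 : ae_eq P setT (EFin \o X) (cst 0%E).
  have : ae_eq P setT (fun t => (Order.min 1 (X t))%R%:E) (cst 0%E).
    apply/ae_eq_integral_abs => //; first exact/measurable_realfun.measurable_EFinP.
    by rewrite -[RHS]Emin; apply: eq_integral => t _; rewrite gee0_abs// lee_fin.
  apply: filterS => t /= /(_ I)[h] _; congr EFin; move: h.
  by case: (leP 1 (X t)) => // _ /eqP; rewrite oner_eq0.
move: EX; rewrite unlock (ae_eq_integral (cst 0%E))//; last first.
  exact/measurable_realfun.measurable_EFinP.
by rewrite integral0 => -[] /eqP; rewrite eq_sym oner_eq0.
Qed.

Lemma max_cf_delta (R : realType) (d : nat) (disp : measure_display)
    (T : measurableType disp) (P : probability T R) (Z : 'I_d -> {RV P >-> R})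
    (x : orthant R d) (j : 'I_d) : sval x = delta_mx ord0 j ->
  max_cf Z x = fine 'E_P[fun t => (Order.max 1 (Z j t))%R]%E.
Proof.
move=> xE; rewrite /max_cf; congr (fine (expectation P _)); apply/funext => t.
rewrite (bigmaxD1 j)//= xE mxE !eqxx mul1r maxC; congr Order.max.
rewrite (eq_bigr (fun=> 0)); last first.
  by move=> i /negbTE ij; rewrite mxE eqxx ij mul0r.
by apply/le_anti; rewrite bigmax_ge_id bigmax_le.
Qed.

Lemma coord_max_delta (R : realType) (d : nat) (j : 'I_d) :
  coord_max (delta_mx ord0 j : 'rV[R]_d) = 1.
Proof.
apply/le_anti/andP; split.
  by apply: bigmax_le => // i _; rewrite mxE lern1 leq_b1.
by apply: (bigmax_sup j) => //; rewrite mxE !eqxx.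
Qed.

Lemma add1_coord_max_not_max_cf (R : realType) (d : nat) : (0 < d)%N ->
  ~ Dnorm_max_cfs R d (fun x => 1 + coord_max (sval x)).
Proof.
move=> hd [disp [T [P [Z [[N [_ [Z0 EZ _]]]]]]]] /esym cfE.
have e0 : [forall i, 0 <= (delta_mx ord0 (Ordinal hd) : 'rV[R]_d) ord0 i].
  by apply/forallP => i; rewrite mxE ler0n.
pose x : orthant R d := exist _ (delta_mx ord0 (Ordinal hd)) e0.
have := congr1 (fun f => f x) cfE.
rewrite (@max_cf_delta _ _ _ _ _ Z x (Ordinal hd))//= coord_max_delta => E2.
apply: (ge0_expectation_max1_neq2 _ _ _ _ _ (Z0 (Ordinal hd)) (EZ (Ordinal hd))).
(* [E2] only concerns [fine], which sends infinite values to [0]; since its value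
   is [2], the expectation is finite. *)
move: E2; case: ('E_P[_])%E => [r /= ->| |] //=;
  by move=> /eqP; rewrite eq_sym paddr_eq0// oner_eq0.
Qed.

Theorem corollary2p14 (R : realType) (d : nat) (hd : (0 < d)%N) :
  exists (phi : nat -> orthant R d -> R) (psi : orthant R d -> R),
    [/\ forall n : nat, Dnorm_max_cfs R d (phi n),
        forall x : orthant R d, (fun n : nat => phi n x) @ \oo --> psi x
      & ~ Dnorm_max_cfs R d psi].
Proof.
exists (fun n => max_cf (rare_vector R d n)).
exists (fun x => 1 + coord_max (sval x)); split.
- move=> n; do 4 eexists; split; last by [].
  exact: rare_vector_Dnorm_generator.
- exact: cvg_max_cf_rare.
- exact: add1_coord_max_not_max_cf.
Qed.
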